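(* Consider the planar quadratic system with real coefficients $$\dot x=a_1x+a_2y+a_3x^2+a_4y^2+a_5xy,\qquad \dot y=b_1x+b_2y+b_3x^2+b_4y^2+b_5xy.$$ There exists an invariant parabola $x=my^2$ of the system if and only if both of the following hold: (1) $a_2=0$, $a_3=2b_5$, $b_3=0$; and (2) one of the following conditions holds: (a) $a_4=0$, $a_1=2b_2$, $a_5\ne 2b_4$ and $b_1\ne 0$ (in this case $m=\frac{a_5-2b_4}{2b_1}$); (b) $a_5=2b_4$, $b_1=0$, $a_4\ne 0$ and $a_1\ne 2b_2$ (in this case $m=\frac{-a_4}{a_1-2b_2}$); (c) $a_4\ne 0$, $a_1\ne 2b_2$, $a_5\ne 2b_4$, $b_1\ne 0$ and $a_1a_5-2a_1b_4-2b_2a_5+4b_2b_4+2a_4b_1=0$ (in this case $m=\frac{a_5-2b_4}{2b_1}=\frac{-a_4}{a_1-2b_2}$); (d) $a_4=0$, $a_1=2b_2$, $a_5=2b_4$ and $b_1=0$ (in this case $x=my^2$ is invariant for all $m\in\mathbb{R}$).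
   Context: A set $S\subseteq\mathbb{R}^2$ is invariant under the flow $\Phi_t$ of a planar system if $\Phi_t(X_0)\in S$ for every $X_0\in S$ and every $t$ in the maximal interval of existence $I(X_0)$ of the solution with initial value $X_0$. For $x=my^2$ to be a parabola one needs $m\neq 0$. *)

(* Defs.v *)
From Stdlib Require Import Reals ClassicalEpsilon.
From Coquelicot Require Import Coquelicot.
Open Scope R_scope.

Definition quadratic_field (a1 a2 a3 a4 a5 b1 b2 b3 b4 b5 : R) (p : R * R) : R * R :=
  let (x, y) := p in
  (a1 * x + a2 * y + a3 * x ^ 2 + a4 * y ^ 2 + a5 * (x * y),
   b1 * x + b2 * y + b3 * x ^ 2 + b4 * y ^ 2 + b5 * (x * y)).

(* The interval ]a, b[ is open, possibly unbounded, and contains the initial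
   time 0; the values of gamma outside it are irrelevant. *)
Definition is_solution (V : R * R -> R * R) (X0 : R * R) (a b : Rbar)
    (gamma : R -> R * R) : Prop :=
  Rbar_lt a 0 /\ Rbar_lt 0 b /\ gamma 0 = X0 /\
  forall t : R, Rbar_lt a t -> Rbar_lt t b ->
    is_derive (fun s => fst (gamma s)) t (fst (V (gamma t))) /\
    is_derive (fun s => snd (gamma s)) t (snd (V (gamma t))).

Definition solution_reaches (V : R * R -> R * R) (X0 : R * R) (t : R)
    (X : R * R) : Prop :=
  exists (a b : Rbar) (gamma : R -> R * R),
    is_solution V X0 a b gamma /\ Rbar_lt a t /\ Rbar_lt t b /\ gamma t = X.

(* I(X0), as the union of all the open intervals around 0 that carry a solution
   with initial value X0. *)
Definition maximal_interval (V : R * R -> R * R) (X0 : R * R) (t : R) : Prop :=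
  exists X : R * R, solution_reaches V X0 t X.

(* Phi_t(X0): for a locally Lipschitz V and t in I(X0), the chosen point is
   unique. The value is unspecified when t is not in I(X0). *)
Definition flow (V : R * R -> R * R) (t : R) (X0 : R * R) : R * R :=
  epsilon (inhabits X0) (solution_reaches V X0 t).

Definition invariant_set (V : R * R -> R * R) (S : R * R -> Prop) : Prop :=
  forall X0 : R * R, S X0 ->
  forall t : R, maximal_interval V X0 t -> S (flow V t X0).

(* A parabola only when m <> 0; for m = 0 this is the line x = 0. *)
Definition parabola (m : R) (p : R * R) : Prop := fst p = m * snd p ^ 2.

(* Main.v *)
Require Import Defs.
From Stdlib Require Import Reals Lra Lia Arith ClassicalEpsilon.
From Coquelicot Require Import Coquelicot.
Open Scope R_scope.

(** The set [x = m y^2] is invariant exactly when the field is tangent to it.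
    If the field is tangent, [h = x - m y^2] satisfies a linear equation
    [h' = k h] along every solution, so [h] stays zero by Gronwall. Conversely,
    through each point of the curve passes a solution, given by a power series
    whose coefficients grow at most geometrically; by uniqueness of solutions
    it is the flow, so [h] vanishes along it and [h'(0) = 0]. Tangency is the
    vanishing of a polynomial of degree five in [y], hence of its coefficients,
    which for [m <> 0] gives
    [a2 = 0], [a3 = 2 b5], [b3 = 0], [a5 - 2 b4 = 2 m b1], [a4 = - m (a1 - 2 b2)]. *)

(** * Gronwall's inequality for a nonnegative function vanishing at 0 *)

Lemma Rbar_lt_segment (a b : Rbar) (t s : R) :
  Rbar_lt a 0 -> Rbar_lt 0 b -> Rbar_lt a t -> Rbar_lt t b ->
  Rmin 0 t <= s <= Rmax 0 t -> Rbar_lt a s /\ Rbar_lt s b.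
Proof.
  intros Ha Hb Hat Htb Hs.
  destruct a as [a| |], b as [b| |]; simpl in *; try easy;
    unfold Rmin, Rmax in Hs; destruct (Rle_dec 0 t); split; trivial; lra.
Qed.

(** Let [M] be the maximum of [k] on the segment and [eps] a sign with [0 <= eps * t]. Then
    [w s * exp (- (eps * M * s))] does not increase on the way from 0 to [t]. It starts at 0 and is
    nonnegative, so it ends at 0. The sign treats forward and backward time together. *)
Lemma gronwall_zero (w dw k : R -> R) (t : R) :
  w 0 = 0 ->
  (forall s, Rmin 0 t <= s <= Rmax 0 t ->
     is_derive w s (dw s) /\ continuity_pt k s /\ Rabs (dw s) <= k s * w s /\
     0 <= w s) ->
  w t = 0.
Proof.
  intros w0 H.
  assert (wt : 0 <= w t) by (apply H; split; [apply Rmin_r | apply Rmax_r]).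
  destruct (continuity_ab_maj k (Rmin 0 t) (Rmax 0 t)) as [sM [HM _]].
  { apply Rle_trans with 0; [apply Rmin_l | apply Rmax_l]. }
  { intros s Hs; apply H, Hs. }
  set (M := k sM) in HM.
  assert (Hb : forall s, Rmin 0 t <= s <= Rmax 0 t -> Rabs (dw s) <= M * w s).
  { intros s Hs. destruct (H s Hs) as (_ & _ & Hk & Hw).
    apply Rle_trans with (1 := Hk), Rmult_le_compat_r; auto. }
  assert (Hexp : exists eps : R, 0 <= eps * t /\ Rabs eps = 1).
  { destruct (Rle_dec 0 t); [exists 1 | exists (-1)]; split; try lra.
    - apply Rabs_R1.
    - rewrite Rabs_left; lra. }
  destruct Hexp as [eps [Heps Habs]].
  set (g := fun s => w s * exp (- (eps * M * s))).
  set (dg := fun s => (dw s - eps * M * w s) * exp (- (eps * M * s))).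
  assert (Hg : forall s, Rmin 0 t <= s <= Rmax 0 t -> is_derive g s (dg s)).
  { intros s Hs. destruct (H s Hs) as (Hd & _).
    unfold g, dg. auto_derive.
    - exists (dw s); exact Hd.
    - erewrite !is_derive_unique by eassumption; ring. }
  destruct (MVT_gen g 0 t dg) as [c [Hc Heq]].
  { intros s Hs; apply Hg; lra. }
  { intros s Hs. apply continuity_pt_filterlim.
    apply (ex_derive_continuous g s). exists (dg s); apply Hg, Hs. }
  assert (Hle : dg c * (t - 0) <= 0).
  { unfold dg. pose proof (exp_pos (- (eps * M * c))) as He.
    specialize (Hb c Hc).
    pose proof (Rle_abs (dw c)). pose proof (Rle_abs (- dw c)) as Hn.
    rewrite Rabs_Ropp in Hn.
    replace ((dw c - eps * M * w c) * exp (- (eps * M * c)) * (t - 0)) with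
      (exp (- (eps * M * c)) * ((dw c - eps * M * w c) * t)) by ring.
    enough ((dw c - eps * M * w c) * t <= 0) by nra.
    unfold Rabs in Habs; destruct (Rcase_abs eps).
    - replace eps with (-1) in * by lra. nra.
    - replace eps with 1 in * by lra. nra. }
  rewrite <- Heq in Hle. unfold g in Hle. rewrite w0 in Hle.
  pose proof (exp_pos (- (eps * M * t))). nra.
Qed.

(** * Power series with recursively defined coefficients *)

(** [prefix n] is a total function that is final up to index [n] and a placeholder beyond. As [F n]
    reads only indices up to [n], it cannot tell [prefix n] from the diagonal sequence
    [prefix k k]. *)
Lemma course_of_values_recursion {A : Type} (F : nat -> (nat -> A) -> A) (x0 : A) :
  (forall n u v, (forall k, (k <= n)%nat -> u k = v k) -> F n u = F n v) ->
  exists u : nat -> A, u O = x0 /\ forall n, u (S n) = F n u.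
Proof.
  intros HF.
  set (prefix := fix prefix (n : nat) : nat -> A :=
    match n with
    | O => fun _ => x0
    | S n' => fun k => if (k <=? n')%nat then prefix n' k else F n' (prefix n')
    end).
  assert (Hp : forall n k, (k <= n)%nat -> prefix n k = prefix k k).
  { induction n as [|n IH]; intros k Hk.
    - now replace k with O by lia.
    - destruct (Nat.eq_dec k (S n)) as [->|Hne]; [easy|].
      simpl. rewrite (proj2 (Nat.leb_le k n)) by lia. apply IH; lia. }
  exists (fun n => prefix n n). split; [easy|].
  intros n.
  change ((if (S n <=? n)%nat then prefix n (S n) else F n (prefix n)) =
          F n (fun k => prefix k k)).
  rewrite (proj2 (Nat.leb_gt (S n) n)) by lia.
  apply HF; apply Hp.
Qed.

(** Each of the [n + 1] products in the convolution is at most [M * K ^ k * (M * K ^ (n - k))],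
    which does not depend on [k]. The factor [INR (S n)] is kept explicit because the recursion for
    Taylor coefficients divides by it. *)
Lemma Rabs_PS_mult_le (u v : nat -> R) (M K : R) (n : nat) :
  (forall k, (k <= n)%nat -> Rabs (u k) <= M * K ^ k) ->
  (forall k, (k <= n)%nat -> Rabs (v k) <= M * K ^ k) ->
  Rabs (PS_mult u v n) <= INR (S n) * (M ^ 2 * K ^ n).
Proof.
  intros Hu Hv. unfold PS_mult.
  eapply Rle_trans; [apply Rsum_abs|].
  rewrite (Rmult_comm (INR (S n))), <- sum_cte.
  apply sum_Rle. intros k Hk. rewrite Rabs_mult.
  replace (M ^ 2 * K ^ n) with (M * K ^ k * (M * K ^ (n - k))).
  - apply Rmult_le_compat; try apply Rabs_pos; [apply Hu | apply Hv]; lia.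
  - replace (K ^ n) with (K ^ k * K ^ (n - k)).
    + ring.
    + rewrite <- pow_add. f_equal. lia.
Qed.

Lemma CV_radius_geometric (u : nat -> R) (M K : R) :
  0 < K -> (forall n, Rabs (u n) <= M * K ^ n) -> Rbar_le (/ K) (CV_radius u).
Proof.
  intros HK Hu. apply CV_radius_bounded. exists M. intros n.
  assert (Hp : 0 <= (/ K) ^ n) by (apply pow_le, Rlt_le, Rinv_0_lt_compat, HK).
  rewrite Rabs_mult, (Rabs_right ((/ K) ^ n)) by (apply Rle_ge, Hp).
  replace M with (M * K ^ n * (/ K) ^ n).
  - apply Rmult_le_compat_r; [exact Hp | apply Hu].
  - rewrite Rmult_assoc, <- Rpow_mult_distr, Rinv_r, pow1; lra.
Qed.

(** The [n]-th Taylor coefficient of one component of the field along a curve whose coordinates have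
    Taylor coefficients [u] and [v]. *)
Definition PS_quadratic (c1 c2 c3 c4 c5 : R) (u v : nat -> R) (n : nat) : R :=
  c1 * u n + c2 * v n + c3 * PS_mult u u n + c4 * PS_mult v v n
  + c5 * PS_mult u v n.

Lemma PS_quadratic_ext c1 c2 c3 c4 c5 u v u' v' n :
  (forall k, (k <= n)%nat -> u k = u' k) ->
  (forall k, (k <= n)%nat -> v k = v' k) ->
  PS_quadratic c1 c2 c3 c4 c5 u v n = PS_quadratic c1 c2 c3 c4 c5 u' v' n.
Proof.
  intros Hu Hv.
  assert (E : forall w z w' z' : nat -> R,
    (forall k, (k <= n)%nat -> w k = w' k) ->
    (forall k, (k <= n)%nat -> z k = z' k) -> PS_mult w z n = PS_mult w' z' n).
  { intros w z w' z' Hw Hz. apply sum_eq. intros k Hk.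
    rewrite Hw, Hz by lia. reflexivity. }
  unfold PS_quadratic.
  rewrite (Hu n), (Hv n), (E u u u' u'), (E v v v' v'), (E u v u' v') by auto.
  reflexivity.
Qed.

Lemma Rabs_PS_quadratic_le c1 c2 c3 c4 c5 u v (M K : R) n :
  1 <= M -> 0 < K ->
  (forall k, (k <= n)%nat -> Rabs (u k) <= M * K ^ k) ->
  (forall k, (k <= n)%nat -> Rabs (v k) <= M * K ^ k) ->
  Rabs (PS_quadratic c1 c2 c3 c4 c5 u v n) <=
    (Rabs c1 + Rabs c2 + Rabs c3 + Rabs c4 + Rabs c5)
    * (INR (S n) * (M ^ 2 * K ^ n)).
Proof.
  intros HM HK Hu Hv. unfold PS_quadratic.
  set (B := INR (S n) * (M ^ 2 * K ^ n)).
  (* The linear terms obey the same bound as the convolutions, since [1 <= M] and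
     [1 <= INR (S n)]. *)
  assert (HB : M * K ^ n <= B).
  { unfold B. pose proof (pow_lt K n HK).
    assert (1 <= INR (S n)) by (rewrite S_INR; pose proof (pos_INR n); lra).
    assert (M * K ^ n <= M ^ 2 * K ^ n) by (apply Rmult_le_compat_r; nra).
    assert (0 <= M ^ 2 * K ^ n) by nra. nra. }
  assert (HC : forall c z, Rabs z <= B -> Rabs (c * z) <= Rabs c * B).
  { intros c z Hz. rewrite Rabs_mult.
    apply Rmult_le_compat_l; [apply Rabs_pos | exact Hz]. }
  pose proof (HC c1 _ (Rle_trans _ _ _ (Hu n (le_n n)) HB)).
  pose proof (HC c2 _ (Rle_trans _ _ _ (Hv n (le_n n)) HB)).
  pose proof (HC c3 _ (Rabs_PS_mult_le _ _ _ _ _ Hu Hu)).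
  pose proof (HC c4 _ (Rabs_PS_mult_le _ _ _ _ _ Hv Hv)).
  pose proof (HC c5 _ (Rabs_PS_mult_le _ _ _ _ _ Hu Hv)).
  rewrite !Rmult_plus_distr_r.
  eapply Rle_trans; [apply Rabs_triang|]. apply Rplus_le_compat; [|assumption].
  eapply Rle_trans; [apply Rabs_triang|]. apply Rplus_le_compat; [|assumption].
  eapply Rle_trans; [apply Rabs_triang|]. apply Rplus_le_compat; [|assumption].
  eapply Rle_trans; [apply Rabs_triang|]. apply Rplus_le_compat; assumption.
Qed.

Lemma is_pseries_PS_quadratic c1 c2 c3 c4 c5 u v (t : R) :
  Rbar_lt (Rabs t) (CV_radius u) -> Rbar_lt (Rabs t) (CV_radius v) ->
  is_pseries (PS_quadratic c1 c2 c3 c4 c5 u v) t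
    (c1 * PSeries u t + c2 * PSeries v t + c3 * PSeries u t ^ 2
     + c4 * PSeries v t ^ 2 + c5 * (PSeries u t * PSeries v t)).
Proof.
  intros Hu Hv.
  pose proof (PSeries_correct _ _ (CV_radius_inside _ _ Hu)) as Pu.
  pose proof (PSeries_correct _ _ (CV_radius_inside _ _ Hv)) as Pv.
  rewrite <- !Rsqr_pow2. unfold Rsqr.
  (* Sums and scalar multiples of series are taken termwise, and products become Cauchy products,
     valid strictly inside both radii of convergence. *)
  repeat match goal with
  | |- is_pseries (PS_quadratic _ _ _ _ _ _ _) _ _ =>
      apply (is_pseries_plus (K := R_AbsRing) (V := R_NormedModule)
        (fun n => c1 * u n + c2 * v n + c3 * PS_mult u u n + c4 * PS_mult v v n)
        (fun n => c5 * PS_mult u v n))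
  | |- is_pseries (fun n => @?f n + @?g n) _ (_ + _) =>
      apply (is_pseries_plus (K := R_AbsRing) (V := R_NormedModule) f g)
  | |- is_pseries (fun n => ?c * @?f n) _ (_ * _) =>
      apply (is_pseries_scal (K := R_AbsRing) (V := R_NormedModule) c f);
        [apply Rmult_comm|]
  | |- is_pseries (fun n => PS_mult _ _ n) _ _ =>
      apply is_pseries_mult; assumption
  end; assumption.
Qed.

(** * Uniqueness and local existence of solutions *)

Lemma solution_continuous (V : R * R -> R * R) X0 a b gamma (t : R) :
  is_solution V X0 a b gamma -> Rbar_lt a t -> Rbar_lt t b ->
  continuous (fun s => fst (gamma s)) t /\ continuous (fun s => snd (gamma s)) t.
Proof.
  intros (_ & _ & _ & H) Ha Hb. destruct (H t Ha Hb) as [H1 H2].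
  split;
    [apply (ex_derive_continuous (K := R_AbsRing) (V := R_NormedModule)
       (fun s => fst (gamma s)))
    |apply (ex_derive_continuous (K := R_AbsRing) (V := R_NormedModule)
       (fun s => snd (gamma s)))]; eexists; eassumption.
Qed.

Section QuadraticField.

Variables a1 a2 a3 a4 a5 b1 b2 b3 b4 b5 : R.

Let V := quadratic_field a1 a2 a3 a4 a5 b1 b2 b3 b4 b5.

Ltac continuity_tac :=
  repeat match goal with
  | |- continuous (fun s => fst (?g s)) _ => assumption
  | |- continuous (fun s => snd (?g s)) _ => assumption
  | |- continuous (fun _ => ?c) _ => apply continuous_const
  | |- continuous (fun s => Rabs (@?f s)) _ =>
      apply (continuous_comp f Rabs); [|apply continuous_Rabs]
  | |- continuous (fun s => @?f s + @?g s) _ =>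
      apply (continuous_plus (V := R_NormedModule) f g)
  | |- continuous (fun s => @?f s - @?g s) _ =>
      apply (continuous_minus (V := R_NormedModule) f g)
  | |- continuous (fun s => @?f s * @?g s) _ =>
      apply (continuous_mult (K := R_AbsRing) f g)
  end.

(** The squared distance [w] of the two solutions vanishes at 0 and satisfies
    [Rabs (dw s) <= k s * w s] with [k] continuous, because a quadratic field has differences that
    are linear in the displacement with coefficients continuous along the solutions. *)
Lemma solution_unique X0 a b gamma a' b' gamma' (t : R) :
  is_solution V X0 a b gamma -> is_solution V X0 a' b' gamma' ->
  Rbar_lt a t -> Rbar_lt t b -> Rbar_lt a' t -> Rbar_lt t b' ->
  gamma t = gamma' t.
Proof.
  intros S S' Hat Htb Hat' Htb'.
  set (x := fun s => fst (gamma s)). set (y := fun s => snd (gamma s)).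
  set (x' := fun s => fst (gamma' s)). set (y' := fun s => snd (gamma' s)).
  set (w := fun s => (x s - x' s) * (x s - x' s) + (y s - y' s) * (y s - y' s)).
  set (dw := fun s =>
    2 * (x s - x' s) * (fst (V (gamma s)) - fst (V (gamma' s))) +
    2 * (y s - y' s) * (snd (V (gamma s)) - snd (V (gamma' s)))).
  (* With [d = x - x'], [e = y - y'], the two components of [V] differ by
     [p d + q e] and [r d + v e]. *)
  set (p := fun s => a1 + a3 * (x s + x' s) + a5 * y s).
  set (q := fun s => a2 + a4 * (y s + y' s) + a5 * x' s).
  set (r := fun s => b1 + b3 * (x s + x' s) + b5 * y s).
  set (v := fun s => b2 + b4 * (y s + y' s) + b5 * x' s).
  assert (Hw : w t = 0).
  { apply (gronwall_zero w dw
      (fun s => 2 * (Rabs (p s) + Rabs (q s) + Rabs (r s) + Rabs (v s)))).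
    - unfold w, x, y, x', y'.
      destruct S as (_ & _ & -> & _), S' as (_ & _ & -> & _). ring.
    - intros s Hs.
      assert (Hs1 : Rbar_lt a s /\ Rbar_lt s b).
      { destruct S as (? & ? & _); eapply Rbar_lt_segment; eassumption. }
      assert (Hs2 : Rbar_lt a' s /\ Rbar_lt s b').
      { destruct S' as (? & ? & _); eapply Rbar_lt_segment; eassumption. }
      destruct Hs1 as [Hs1 Hs1'], Hs2 as [Hs2 Hs2'].
      destruct (solution_continuous _ _ _ _ _ _ S Hs1 Hs1') as [Cx Cy].
      destruct (solution_continuous _ _ _ _ _ _ S' Hs2 Hs2') as [Cx' Cy'].
      split; [|split; [|split]].
      + destruct S as (_ & _ & _ & D), S' as (_ & _ & _ & D').
        destruct (D s Hs1 Hs1') as [Dx Dy], (D' s Hs2 Hs2') as [Dx' Dy'].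
        fold x in Dx. fold y in Dy. fold x' in Dx'. fold y' in Dy'.
        unfold w, dw. auto_derive.
        * repeat split; eexists; eassumption.
        * erewrite !is_derive_unique by eassumption.
          ring.
      + apply continuity_pt_filterlim.
        change (continuous
          (fun s => 2 * (Rabs (p s) + Rabs (q s) + Rabs (r s) + Rabs (v s))) s).
        unfold p, q, r, v, x, y, x', y'. continuity_tac.
      + assert (E : dw s = 2 * ((x s - x' s) * (x s - x' s) * p s
                  + (x s - x' s) * (y s - y' s) * (q s + r s)
                  + (y s - y' s) * (y s - y' s) * v s)).
        { unfold dw, p, q, r, v, x, y, x', y', V.
          destruct (gamma s) as [X Y], (gamma' s) as [X' Y']; simpl. ring. }
        rewrite E; unfold w.
        generalize (x s - x' s) (y s - y' s) (p s) (q s) (r s) (v s).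
        clear. intros d e p q r v.
        assert (B : forall z c n, Rabs z <= n -> Rabs (z * c) <= Rabs c * n).
        { intros z c n Hz. rewrite Rabs_mult, Rmult_comm.
          apply Rmult_le_compat_l; [apply Rabs_pos | exact Hz]. }
        set (n := d * d + e * e).
        pose proof (Rle_0_sqr d). pose proof (Rle_0_sqr e).
        (* Nonnegativity of the squares of [d + e] and [d - e] bounds the mixed product [d * e] by
           [n] in absolute value. *)
        pose proof (Rle_0_sqr (d + e)). pose proof (Rle_0_sqr (d - e)).
        unfold Rsqr in *.
        assert (B1 : Rabs (d * d) <= n) by (apply Rabs_le; unfold n; lra).
        assert (B2 : Rabs (d * e) <= n) by (apply Rabs_le; unfold n; lra).
        assert (B3 : Rabs (e * e) <= n) by (apply Rabs_le; unfold n; lra).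
        rewrite Rabs_mult, (Rabs_right 2) by lra.
        pose proof (B _ p _ B1). pose proof (B _ q _ B2).
        pose proof (B _ r _ B2). pose proof (B _ v _ B3).
        rewrite Rmult_plus_distr_l.
        pose proof (Rabs_triang (d * d * p + (d * e * q + d * e * r)) (e * e * v)).
        pose proof (Rabs_triang (d * d * p) (d * e * q + d * e * r)).
        pose proof (Rabs_triang (d * e * q) (d * e * r)).
        lra.
      + apply Rplus_le_le_0_compat; apply Rle_0_sqr. }
  unfold w, x, y, x', y' in Hw.
  destruct (gamma t) as [X Y], (gamma' t) as [X' Y']; simpl in Hw.
  destruct (Rplus_sqr_eq_0 _ _ Hw).
  f_equal; apply Rminus_diag_uniq; assumption.
Qed.

(** The point chosen by [epsilon] is reached by some solution, possibly on another interval;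
    uniqueness identifies its value at [t] with that of [gamma]. *)
Lemma flow_eq X0 a b gamma (t : R) :
  is_solution V X0 a b gamma -> Rbar_lt a t -> Rbar_lt t b ->
  flow V t X0 = gamma t.
Proof.
  intros S Ha Hb.
  assert (E : solution_reaches V X0 t (flow V t X0)).
  { unfold flow. apply epsilon_spec. exists (gamma t), a, b, gamma. auto. }
  destruct E as (a' & b' & gamma' & S' & Ha' & Hb' & <-).
  eapply solution_unique; eassumption.
Qed.

Lemma local_solution_exists (X0 : R * R) :
  exists (r : R) (gamma : R -> R * R), 0 < r /\
    is_solution V X0 (Finite (- r)) (Finite r) gamma.
Proof.
  set (P := PS_quadratic a1 a2 a3 a4 a5). set (Q := PS_quadratic b1 b2 b3 b4 b5).
  (* Comparing coefficients in the differential equation gives [(n + 1) u (n + 1) = P u v n], and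
     likewise for [v] and [Q]. The sequence is pair-valued because each recursion uses both
     coordinates. *)
  destruct (course_of_values_recursion
    (fun n u => (P (fun k => fst (u k)) (fun k => snd (u k)) n / INR (S n),
                 Q (fun k => fst (u k)) (fun k => snd (u k)) n / INR (S n))) X0)
    as [c [c0 cS]].
  { intros n f g Hfg. unfold P, Q.
    f_equal; f_equal; apply PS_quadratic_ext; intros k Hk; now rewrite Hfg. }
  set (u := fun k => fst (c k)) in cS. set (v := fun k => snd (c k)) in cS.
  assert (uS : forall n, u (S n) = P u v n / INR (S n))
    by (intros n; unfold u at 1; now rewrite cS).
  assert (vS : forall n, v (S n) = Q u v n / INR (S n))
    by (intros n; unfold v at 1; now rewrite cS).
  (* [M] dominates the coefficients of index 0, and [A] dominates the coefficient sums of both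
     components; the summand 1 makes both at least 1. *)
  set (M := 1 + Rabs (fst X0) + Rabs (snd X0)).
  set (A := 1 + (Rabs a1 + Rabs a2 + Rabs a3 + Rabs a4 + Rabs a5)
              + (Rabs b1 + Rabs b2 + Rabs b3 + Rabs b4 + Rabs b5)).
  pose proof (Rabs_pos (fst X0)). pose proof (Rabs_pos (snd X0)).
  pose proof (Rabs_pos a1). pose proof (Rabs_pos a2). pose proof (Rabs_pos a3).
  pose proof (Rabs_pos a4). pose proof (Rabs_pos a5).
  pose proof (Rabs_pos b1). pose proof (Rabs_pos b2). pose proof (Rabs_pos b3).
  pose proof (Rabs_pos b4). pose proof (Rabs_pos b5).
  assert (HM : 1 <= M) by (unfold M; lra).
  assert (HA : 1 <= A) by (unfold A; lra).
  (* The recursion divides a convolution of [n + 1] terms by [n + 1], so the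
     bound [M K^n] propagates as soon as [A M^2 K^n <= M K^(n+1)]. *)
  set (K := A * M).
  assert (HK : 0 < K) by (unfold K; nra).
  assert (step : forall n z B, B <= A ->
            Rabs z <= B * (INR (S n) * (M ^ 2 * K ^ n)) ->
            Rabs (z / INR (S n)) <= M * K ^ S n).
  { intros n z B HB Hz. pose proof (lt_0_INR (S n) (Nat.lt_0_succ n)) as Hn.
    unfold Rdiv. rewrite Rabs_mult, (Rabs_right (/ INR (S n)))
      by (apply Rle_ge, Rlt_le, Rinv_0_lt_compat, Hn).
    apply Rmult_le_reg_r with (1 := Hn).
    rewrite Rmult_assoc, Rinv_l, Rmult_1_r by lra.
    apply Rle_trans with (1 := Hz).
    replace (M * K ^ S n * INR (S n)) with (A * (INR (S n) * (M ^ 2 * K ^ n)))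
      by (simpl; unfold K; ring).
    apply Rmult_le_compat_r; [|exact HB].
    pose proof (pow_lt K n HK).
    apply Rmult_le_pos; [lra | apply Rmult_le_pos; [nra | lra]]. }
  assert (bound : forall n, Rabs (u n) <= M * K ^ n /\ Rabs (v n) <= M * K ^ n).
  { intros n. induction n as [n IH] using lt_wf_ind. destruct n as [|n].
    - unfold u, v. rewrite c0. unfold M. simpl. lra.
    - assert (IHu : forall k, (k <= n)%nat -> Rabs (u k) <= M * K ^ k)
        by (intros k Hk; apply IH; lia).
      assert (IHv : forall k, (k <= n)%nat -> Rabs (v k) <= M * K ^ k)
        by (intros k Hk; apply IH; lia).
      rewrite uS, vS. split; eapply step.
      2: { now apply Rabs_PS_quadratic_le. }
      3: { now apply Rabs_PS_quadratic_le. }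
      all: unfold A; lra. }
  exists (/ K), (fun t => (PSeries u t, PSeries v t)).
  assert (Hr : 0 < / K) by (apply Rinv_0_lt_compat, HK).
  split; [exact Hr|]. split; [simpl; lra|]. split; [simpl; lra|]. split.
  { rewrite !PSeries_0. unfold u, v. rewrite c0. now destruct X0. }
  intros t Ht1 Ht2. simpl in Ht1, Ht2.
  assert (HT : Rbar_lt (Rabs t) (/ K)) by (simpl; apply Rabs_def1; lra).
  assert (Cu : Rbar_lt (Rabs t) (CV_radius u)).
  { eapply Rbar_lt_le_trans; [exact HT|].
    apply (CV_radius_geometric u M K HK). intros n; apply bound. }
  assert (Cv : Rbar_lt (Rabs t) (CV_radius v)).
  { eapply Rbar_lt_le_trans; [exact HT|].
    apply (CV_radius_geometric v M K HK). intros n; apply bound. }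
  assert (derive : forall w c1 c2 c3 c4 c5, Rbar_lt (Rabs t) (CV_radius w) ->
    (forall n, w (S n) = PS_quadratic c1 c2 c3 c4 c5 u v n / INR (S n)) ->
    is_derive (PSeries w) t
      (c1 * PSeries u t + c2 * PSeries v t + c3 * PSeries u t ^ 2
       + c4 * PSeries v t ^ 2 + c5 * (PSeries u t * PSeries v t))).
  { intros w c1 c2 c3 c4 c5 Cw wS.
    (* The value of the field is the sum of the series [PS_quadratic], whose coefficients are those
       of the termwise derivative of [w]. *)
    rewrite <- (is_pseries_unique _ _ _
      (is_pseries_PS_quadratic c1 c2 c3 c4 c5 u v t Cu Cv)).
    rewrite <- (PSeries_ext (PS_derive w)); [now apply is_derive_PSeries|].
    intros n. unfold PS_derive. rewrite wS. field. apply not_0_INR. lia. }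
  split; now apply derive.
Qed.

(** * Invariance as tangency, and tangency as equations on the coefficients *)

(** The right-hand side says that the field is orthogonal to the gradient [(1, - 2 m y)] of
    [x - m y^2] on the curve. The value [m = 0] is included, as the last case of the theorem covers
    every [m]. *)
Lemma invariant_parabola_iff_tangent (m : R) :
  invariant_set V (parabola m) <->
  forall y, fst (V (m * y ^ 2, y)) = 2 * m * y * snd (V (m * y ^ 2, y)).
Proof.
  split.
  - intros Hinv y.
    destruct (local_solution_exists (m * y ^ 2, y)) as (r & gamma & Hr & Sg).
    assert (Hpar : forall t, - r < t < r -> fst (gamma t) - m * snd (gamma t) ^ 2 = 0).
    { intros t Ht.
      assert (Hp : parabola m (flow V t (m * y ^ 2, y))).
      { apply Hinv; [reflexivity|].
        exists (gamma t), (Finite (- r)), (Finite r), gamma.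
        split; [exact Sg|]. split; [|split; [|reflexivity]]; simpl; lra. }
      rewrite (flow_eq _ _ _ _ t Sg) in Hp by (simpl; lra).
      unfold parabola in Hp. lra. }
    destruct Sg as (_ & _ & g0 & D).
    destruct (D 0) as [Dx Dy]; try (simpl; lra).
    assert (D0 : is_derive (fun t => fst (gamma t) - m * snd (gamma t) ^ 2) 0
       (fst (V (gamma 0)) - m * (2 * snd (gamma 0) * snd (V (gamma 0))))).
    { set (u := fun t => fst (gamma t)) in Dx.
      set (v := fun t => snd (gamma t)) in Dy.
      change (is_derive (fun t => u t - m * v t ^ 2) 0
        (fst (V (gamma 0)) - m * (2 * v 0 * snd (V (gamma 0))))).
      auto_derive.
      - repeat split; eexists; eassumption.
      - erewrite !is_derive_unique by eassumption. ring. }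
    (* The same derivative computed a second way: the function is identically 0 near 0. Equating it
       with the chain rule value gives tangency at the starting point. *)
    assert (D0' : is_derive (fun t => fst (gamma t) - m * snd (gamma t) ^ 2) 0 0).
    { apply is_derive_ext_loc with (fun _ => 0); [|apply (is_derive_const 0)].
      exists (mkposreal r Hr). intros t Ht. symmetry; apply Hpar.
      change (Rabs (t - 0) < r) in Ht. apply Rabs_def2 in Ht. lra. }
    pose proof (is_derive_unique _ _ _ D0) as E.
    rewrite (is_derive_unique _ _ _ D0'), g0 in E. cbn [snd fst] in E. lra.
  - intros Htan X0 HX0 t (X & a & b & gamma & Sg & Hat & Htb & _).
    rewrite (flow_eq _ _ _ _ t Sg Hat Htb).
    set (x := fun s => fst (gamma s)). set (y := fun s => snd (gamma s)).
    set (h := fun s => x s - m * (y s * y s)).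
    (* By tangency, [x' - 2 m y y' = k (x - m y^2)]. *)
    set (k := fun s => a1 + a3 * (x s + m * (y s * y s)) + a5 * y s
       - 2 * m * y s * (b1 + b3 * (x s + m * (y s * y s)) + b5 * y s)).
    (* The square of [h] is used because [gronwall_zero] asks for a nonnegative function. *)
    assert (Hh : h t * h t = 0).
    { apply (gronwall_zero (fun s => h s * h s) (fun s => 2 * (k s * (h s * h s)))
        (fun s => 2 * Rabs (k s)) t).
      - unfold h, x, y. destruct Sg as (_ & _ & -> & _).
        unfold parabola in HX0. rewrite HX0. ring.
      - intros s Hs.
        assert (Hs1 : Rbar_lt a s /\ Rbar_lt s b).
        { destruct Sg as (? & ? & _); eapply Rbar_lt_segment; eassumption. }
        destruct Hs1 as [Hs1 Hs1'].
        destruct (solution_continuous _ _ _ _ _ _ Sg Hs1 Hs1') as [Cx Cy].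
        split; [|split; [|split]].
        + destruct Sg as (_ & _ & _ & D).
          destruct (D s Hs1 Hs1') as [Dx Dy]. fold x in Dx. fold y in Dy.
          unfold h. auto_derive.
          * repeat split; eexists; eassumption.
          * erewrite !is_derive_unique by eassumption.
            (* Subtract the tangency relation at [(m y^2, y)]: between this point and [(x, y)] each
               component of the field changes by a multiple of [x - m y^2]. *)
            assert (E : fst (V (gamma s)) - 2 * m * y s * snd (V (gamma s))
                        = k s * (x s - m * (y s * y s))).
            { specialize (Htan (y s)). unfold k, x, y in *.
              destruct (gamma s) as [X1 Y1]. simpl in *. lra. }
            replace (fst (V (gamma s))) with
              (2 * m * y s * snd (V (gamma s)) + k s * (x s - m * (y s * y s))) by lra.
            ring.
        + apply continuity_pt_filterlim.
          change (continuous (fun s => 2 * Rabs (k s)) s).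
          unfold k, x, y. continuity_tac.
        + rewrite !Rabs_mult, (Rabs_right 2) by lra.
          rewrite <- (Rabs_mult (h s)), (Rabs_right (h s * h s)) by nra. lra.
        + nra. }
    unfold h, x, y in Hh. unfold parabola. nra.
Qed.

Lemma invariant_parabola_iff (m : R) : m <> 0 ->
  (invariant_set V (parabola m) <->
   a2 = 0 /\ a3 = 2 * b5 /\ b3 = 0 /\ a5 - 2 * b4 = 2 * m * b1 /\
   a4 = - m * (a1 - 2 * b2)).
Proof.
  intros Hm. rewrite invariant_parabola_iff_tangent. split.
  - intros H.
    (* The tangency polynomial has degree at most five and no constant term, so five distinct
       nonzero values of [y] determine its coefficients. *)
    pose proof (H 1) as H1. pose proof (H (-1)) as H1'.
    pose proof (H 2) as H2. pose proof (H (-2)) as H2'. pose proof (H 3) as H3.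
    simpl in H1, H1', H2, H2', H3.
    assert (E1 : a2 = 0) by lra.
    assert (E2 : a4 = - m * (a1 - 2 * b2)) by lra.
    assert (E3 : m * (a5 - 2 * b4 - 2 * m * b1) = 0) by lra.
    assert (E4 : m * (m * (a3 - 2 * b5)) = 0) by lra.
    assert (E5 : m * (m * (m * b3)) = 0) by lra.
    (* The coefficients of [y^3], [y^4], [y^5] carry one, two and three factors [m] respectively. *)
    assert (cancel : forall z, m * z = 0 -> z = 0).
    { intros z Hz. destruct (Rmult_integral _ _ Hz); easy. }
    apply cancel in E3. do 2 apply cancel in E4. do 3 apply cancel in E5.
    repeat split; lra.
  - intros (-> & -> & -> & E5 & ->) y. simpl.
    replace a5 with (2 * b4 + 2 * m * b1) by lra. ring.
Qed.

End QuadraticField.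

(** * Solving the two remaining equations for [m], case by case *)

Theorem theorem3p5 (a1 a2 a3 a4 a5 b1 b2 b3 b4 b5 : R) :
  let V := quadratic_field a1 a2 a3 a4 a5 b1 b2 b3 b4 b5 in
  ((exists m : R, m <> 0 /\ invariant_set V (parabola m)) <->
   (a2 = 0 /\ a3 = 2 * b5 /\ b3 = 0) /\
   ((a4 = 0 /\ a1 = 2 * b2 /\ a5 <> 2 * b4 /\ b1 <> 0) \/
    (a5 = 2 * b4 /\ b1 = 0 /\ a4 <> 0 /\ a1 <> 2 * b2) \/
    (a4 <> 0 /\ a1 <> 2 * b2 /\ a5 <> 2 * b4 /\ b1 <> 0 /\
     a1 * a5 - 2 * a1 * b4 - 2 * b2 * a5 + 4 * b2 * b4 + 2 * a4 * b1 = 0) \/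
    (a4 = 0 /\ a1 = 2 * b2 /\ a5 = 2 * b4 /\ b1 = 0))) /\
  (a2 = 0 /\ a3 = 2 * b5 /\ b3 = 0 ->
   (a4 = 0 /\ a1 = 2 * b2 /\ a5 <> 2 * b4 /\ b1 <> 0 ->
    forall m : R, (m <> 0 /\ invariant_set V (parabola m)) <->
      m = (a5 - 2 * b4) / (2 * b1)) /\
   (a5 = 2 * b4 /\ b1 = 0 /\ a4 <> 0 /\ a1 <> 2 * b2 ->
    forall m : R, (m <> 0 /\ invariant_set V (parabola m)) <->
      m = - a4 / (a1 - 2 * b2)) /\
   (a4 <> 0 /\ a1 <> 2 * b2 /\ a5 <> 2 * b4 /\ b1 <> 0 /\
    a1 * a5 - 2 * a1 * b4 - 2 * b2 * a5 + 4 * b2 * b4 + 2 * a4 * b1 = 0 ->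
    (a5 - 2 * b4) / (2 * b1) = - a4 / (a1 - 2 * b2) /\
    forall m : R, (m <> 0 /\ invariant_set V (parabola m)) <->
      m = (a5 - 2 * b4) / (2 * b1)) /\
   (a4 = 0 /\ a1 = 2 * b2 /\ a5 = 2 * b4 /\ b1 = 0 ->
    forall m : R, invariant_set V (parabola m))).
Proof.
  intros V.
  assert (I := invariant_parabola_iff a1 a2 a3 a4 a5 b1 b2 b3 b4 b5).
  fold V in I.
  assert (half : forall m, b1 <> 0 ->
    (a5 - 2 * b4 = 2 * m * b1 <-> m = (a5 - 2 * b4) / (2 * b1))).
  { intros m Hb. split; [intros ->; now field | intros ->; now field]. }
  assert (quot : forall m, a1 <> 2 * b2 ->
    (a4 = - m * (a1 - 2 * b2) <-> m = - a4 / (a1 - 2 * b2))).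
  { intros m Ha. split; [intros -> | intros ->]; field; lra. }
  (* In case (a) the equation for [a4] reads [0 = 0] and the other one determines [m], nonzero
     because [a5 <> 2 * b4]. Case (b) exchanges the roles of the two equations. *)
  assert (Ca : a2 = 0 /\ a3 = 2 * b5 /\ b3 = 0 ->
    a4 = 0 /\ a1 = 2 * b2 /\ a5 <> 2 * b4 /\ b1 <> 0 ->
    forall m : R, (m <> 0 /\ invariant_set V (parabola m)) <->
      m = (a5 - 2 * b4) / (2 * b1)).
  { intros (E1 & E2 & E3) (E4 & E5 & N1 & N2) m. rewrite <- (half m N2). split.
    - intros [Hm Hi]. now apply I in Hi.
    - intros E. assert (Hm : m <> 0) by (intros ->; lra).
      split; [exact Hm|]. apply I; [exact Hm|]. repeat split; trivial.
      rewrite E4, E5; ring. }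
  assert (Cb : a2 = 0 /\ a3 = 2 * b5 /\ b3 = 0 ->
    a5 = 2 * b4 /\ b1 = 0 /\ a4 <> 0 /\ a1 <> 2 * b2 ->
    forall m : R, (m <> 0 /\ invariant_set V (parabola m)) <->
      m = - a4 / (a1 - 2 * b2)).
  { intros (E1 & E2 & E3) (E4 & E5 & N1 & N2) m. rewrite <- (quot m N2). split.
    - intros [Hm Hi]. now apply I in Hi.
    - intros E. assert (Hm : m <> 0) by (intros ->; lra).
      split; [exact Hm|]. apply I; [exact Hm|]. repeat split; trivial.
      rewrite E4, E5; ring. }
  assert (Cc : a2 = 0 /\ a3 = 2 * b5 /\ b3 = 0 ->
    a4 <> 0 /\ a1 <> 2 * b2 /\ a5 <> 2 * b4 /\ b1 <> 0 /\
    a1 * a5 - 2 * a1 * b4 - 2 * b2 * a5 + 4 * b2 * b4 + 2 * a4 * b1 = 0 ->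
    (a5 - 2 * b4) / (2 * b1) = - a4 / (a1 - 2 * b2) /\
    forall m : R, (m <> 0 /\ invariant_set V (parabola m)) <->
      m = (a5 - 2 * b4) / (2 * b1)).
  { intros (E1 & E2 & E3) (N1 & N2 & N3 & N4 & E).
    (* The polynomial condition of case (c) is [(a5 - 2 b4) (a1 - 2 b2) + 2 a4 b1 = 0], the
       cross-multiplied equality of the two values of [m]. *)
    assert (Eq : (a5 - 2 * b4) / (2 * b1) = - a4 / (a1 - 2 * b2)).
    { apply (quot _ N2). apply Rmult_eq_reg_r with (2 * b1); [|lra].
      replace (- ((a5 - 2 * b4) / (2 * b1)) * (a1 - 2 * b2) * (2 * b1))
        with (- (a5 - 2 * b4) * (a1 - 2 * b2)) by (field; lra). lra. }
    split; [exact Eq|]. intros m. split.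
    - intros [Hm Hi]. apply (half m N4). now apply I in Hi.
    - intros Em. pose proof (proj2 (half m N4) Em) as F1.
      rewrite Eq in Em. pose proof (proj2 (quot m N2) Em) as F2.
      assert (Hm : m <> 0) by (intros ->; lra).
      split; [exact Hm|]. now apply I. }
  assert (Cd : a2 = 0 /\ a3 = 2 * b5 /\ b3 = 0 ->
    a4 = 0 /\ a1 = 2 * b2 /\ a5 = 2 * b4 /\ b1 = 0 ->
    forall m : R, invariant_set V (parabola m)).
  { intros (E1 & E2 & E3) (E4 & E5 & E6 & E7) m.
    apply invariant_parabola_iff_tangent. intros y. simpl. subst. ring. }
  split; [split|].
  - intros (m & Hm & Hi). apply I in Hi; [|exact Hm].
    destruct Hi as (E1 & E2 & E3 & E4 & E5). split; [tauto|].
    assert (Z : forall z, m * z = 0 -> z = 0).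
    { intros z Hz. destruct (Rmult_integral _ _ Hz); easy. }
    (* As [m <> 0], the two sides of each equation vanish together. Whether [a4] and [b1] are zero
       therefore selects exactly one of the four cases. *)
    assert (H5 : a5 = 2 * b4 <-> b1 = 0).
    { split; [intros F; apply Z; lra | intros F; rewrite F in E4; lra]. }
    assert (H1 : a4 = 0 <-> a1 = 2 * b2).
    { split; [intros F; apply Rminus_diag_uniq, Z; lra
             | intros F; rewrite E5, F; ring]. }
    clear I half quot Ca Cb Cc Cd.
    destruct (Req_dec a4 0) as [F4|F4], (Req_dec b1 0) as [F1|F1].
    + right; right; right. tauto.
    + left. tauto.
    + right; left. tauto.
    + right; right; left. split; [|split; [|split; [|split]]]; try tauto.
      replace a5 with (2 * b4 + 2 * m * b1) by lra. rewrite E5. ring.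
  - intros [E [C|[C|[C|C]]]].
    + eexists. now apply (Ca E C).
    + eexists. now apply (Cb E C).
    + eexists. now apply (proj2 (Cc E C)).
    (* Every [m] works in case (d), so any nonzero witness will do. *)
    + exists 1. split; [lra | now apply Cd].
  - auto.
Qed.
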